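(* Let $\mathbf n=(n_1,\ldots,n_k)\in\mathbb N^k$ be such that $n_i\ge2$ for all $i$ and let $t\in[0,1]$. Then there exists a pure element $\mathbf T$ in the polyball $\mathbf B_{\mathbf n}$ such that $\mathrm{rank}(\mathbf T)=1$ and $$\chi(\mathbf T)=t.$$
   Context: All Hilbert spaces are complex. $B(\mathcal H)^{n_1}\times_c\cdots\times_cB(\mathcal H)^{n_k}$ is the set of tuples $\mathbf X=(X_1,\ldots,X_k)$, $X_i=(X_{i,1},\ldots,X_{i,n_i})\in B(\mathcal H)^{n_i}$, such that every entry of $X_s$ commutes with every entry of $X_t$ for $s\ne t$ (entries of one $X_i$ need not commute). $\Phi_{X_i}(Y):=\sum_{j=1}^{n_i}X_{i,j}YX_{i,j}^*$, and for $\mathbf p\in\{0,1\}^k$, $\mathbf\Delta_{\mathbf X}^{\mathbf p}:=(id-\Phi_{X_1})^{p_1}\circ\cdots\circ(id-\Phi_{X_k})^{p_k}$. $\mathbf B_{\mathbf n}(\mathcal H)$ is the set of such $\mathbf X$ with $\mathbf\Delta_{\mathbf X}^{\mathbf p}(I)\ge0$ for all $\mathbf p\in\{0,1\}^k$, and $\mathbf B_{\mathbf n}=\{\mathbf B_{\mathbf n}(\mathcal H):\mathcal H\text{ a Hilbert space}\}$; an element of $\mathbf B_{\mathbf n}$ is an element of some $\mathbf B_{\mathbf n}(\mathcal H)$. $\mathbf X$ is pure if $\Phi_{X_i}^p(I)\to0$ strongly as $p\to\infty$ for each $i$. The defect operator is $\mathbf\Delta_{\mathbf X}(I):=(id-\Phi_{X_1})\circ\cdots\circ(id-\Phi_{X_k})(I)$,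 and $\mathrm{rank}(\mathbf X)$ is the rank of $\mathbf\Delta_{\mathbf X}(I)$. $\mathbb F_{n_i}^+$ is the unital free semigroup on generators $g_1^i,\ldots,g_{n_i}^i$ with identity $g_0^i$, $|\alpha|$ denotes word length, $X_{i,\alpha}:=X_{i,j_1}\cdots X_{i,j_p}$ for $\alpha=g^i_{j_1}\cdots g^i_{j_p}$, $X_{i,g_0^i}:=I$. For $\mathbf q\in\mathbb Z_+^k$, $M_{\mathbf q}(\mathbf X):=\mathrm{span}\{X_{1,\alpha_1}\cdots X_{k,\alpha_k}h:|\alpha_i|\le q_i,\ h\in\mathbf\Delta_{\mathbf X}(I)(\mathcal H)\}$. The Euler characteristic of $\mathbf X$ with finite rank defect is $$\chi(\mathbf X):=\lim_{m\to\infty}\frac{\dim M_{\mathbf q^{(m)}}(\mathbf X)}{\prod_{i=1}^k(1+n_i+\cdots+n_i^{q_i^{(m)}})}$$ for any increasing cofinal sequence $\mathbf q^{(m)}$ in $\mathbb Z_+^k$ (the limit exists and is independent of the sequence). *)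

(* Defs.v *)
From HB Require Import structures.
From mathcomp Require Import all_boot all_order all_algebra.
From mathcomp Require Import all_classical all_reals all_analysis.
From mathcomp Require Export complex.

Set Implicit Arguments.
Unset Strict Implicit.
Unset Printing Implicit Defensive.

Import Order.TTheory GRing.Theory Num.Theory.
Import numFieldNormedType.Exports.

Local Open Scope classical_set_scope.
Local Open Scope ring_scope.
Local Open Scope complex_scope.

(* The inner product is linear in its first argument, conjugate-linear in the
   second. *)
Record hilbertType (R : realType) := Hilbert {
  hilbert_sort :> completeNormedModType R[i];
  inner : {dot hilbert_sort for (@Num.conj R[i])};
  normE : forall x : hilbert_sort, `|x| ^+ 2 = inner x x }.

Arguments inner {R h}.

Section LinearSpan.
Variables (K : numFieldType) (V : lmodType K).

Definition lspan (A : set V) : set V :=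
  [set v | exists (d : nat) (a : 'I_d -> K) (e : 'I_d -> V),
     (forall i, A (e i)) /\ v = \sum_i a i *: e i].

Definition lin_indep (d : nat) (e : 'I_d -> V) : Prop :=
  forall a : 'I_d -> K, \sum_i a i *: e i = 0 -> forall i, a i = 0.

Definition has_dim (A : set V) (d : nat) : Prop :=
  exists e : 'I_d -> V, lin_indep e /\ A = lspan (range e).

(* 0 by convention when A is not a finite-dimensional subspace *)
Definition lin_dim (A : set V) : nat := xget 0%N (has_dim A).

End LinearSpan.

Section Operators.
Variables (R : realType) (H : hilbertType R).
Implicit Types (A Y : H -> H).

Definition bounded_operator A : Prop :=
  linear A /\ exists M : R, forall x, `|A x| <= M%:C * `|x|.

(* For bounded A the vector z below exists by the Riesz representation theorem
   and is unique; the default value 0 then plays no role. *)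
Definition adjoint A : H -> H :=
  fun y => xget 0 [set z | forall x, inner (A x) y = inner x z].

(* The order of R[i] is such that 0 <= z means that z is real and nonnegative. *)
Definition positive_operator A : Prop := forall x, 0 <= inner (A x) x.

Definition Phi (m : nat) (X : 'I_m -> H -> H) (Y : H -> H) : H -> H :=
  fun h => \sum_(j < m) X j (Y (adjoint (X j) h)).

End Operators.

(* Tuples X = (X_1, ..., X_k) with X_i = (X_{i,1}, ..., X_{i,n_i}) *)
Section Polyball.
Variables (R : realType) (H : hilbertType R) (k : nat) (n : 'I_k -> nat).
Variable X : forall i : 'I_k, 'I_(n i) -> H -> H.

(* The composition over i is taken in the order of 'I_k, and the exponent p i is
   a boolean, read as 0 or 1. *)
Definition Delta_pow (p : 'I_k -> bool) : (H -> H) -> (H -> H) :=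
  \big[(fun F G => F \o G)/idfun]_(i < k)
     iter (p i) (fun Y h => Y h - Phi (@X i) Y h).

Definition defect : H -> H := Delta_pow (fun=> true) idfun.

Definition cross_commuting : Prop :=
  forall (s t : 'I_k) (a : 'I_(n s)) (b : 'I_(n t)), s != t ->
    X a \o X b = X b \o X a.

Definition polyball : Prop :=
  [/\ forall (i : 'I_k) (j : 'I_(n i)), bounded_operator (X j),
      cross_commuting
    & forall p : 'I_k -> bool, positive_operator (Delta_pow p idfun)].

Definition pure : Prop :=
  forall (i : 'I_k) (h : H),
    iter p (Phi (@X i)) idfun h @[p --> \oo] --> (0 : H).

Definition rank : nat := lin_dim (range defect).

(* The free semigroup F_{n_i}^+ is the type of words over 'I_(n i): length is
   size and the identity is the empty word. *)
Definition word_op (i : 'I_k) (alpha : seq 'I_(n i)) : H -> H :=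
  foldr (fun j A => X j \o A) idfun alpha.

Definition M_space (q : 'I_k -> nat) : set H :=
  lspan [set v | exists (alpha : forall i : 'I_k, seq 'I_(n i)) (h : H),
    [/\ forall i, (size (alpha i) <= q i)%N, range defect h
      & v = (\big[(fun A B => A \o B)/idfun]_(i < k) word_op (alpha i)) h]].

Definition euler_ratio (q : 'I_k -> nat) : R :=
  (lin_dim (M_space q))%:R / (\prod_(i < k) \sum_(l < (q i).+1) n i ^ l)%N%:R.

Definition increasing_cofinal (q : nat -> 'I_k -> nat) : Prop :=
  (forall m i, (q m i <= q m.+1 i)%N) /\
  (forall r : 'I_k -> nat, exists m, forall i, (r i <= q m i)%N).

(* The defect has finite rank and chi is the limit of the ratios along every
   increasing cofinal sequence, i.e. the Euler characteristic of X is defined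
   and equals chi. *)
Definition has_euler_characteristic (chi : R) : Prop :=
  (exists d, has_dim (range defect) d) /\
  forall q : nat -> 'I_k -> nat, increasing_cofinal q ->
    euler_ratio (q m) @[m --> \oo] --> chi.

End Polyball.

(* Main.v *)
Require Import Defs.
From HB Require Import structures.
From mathcomp Require Import all_boot all_order all_algebra.
From mathcomp Require Import all_classical all_reals all_analysis.
From mathcomp Require Import finmap zify ring lra.
From mathcomp.analysis.showcase Require summability.

(** Let [W] be the set of [k]-tuples of words, one over each alphabet
    ['I_(n i)], and let [D] be a subset of [W] that contains the empty tuple and
    is stable under removal of the first letter of any word of the tuple. On the
    Hilbert space with orthonormal basis [D], let [T i j] send the basis vector
    of [w] to that of the tuple obtained by putting the letter [j] in front of
    [w i], or to [0] if that tuple is not in [D]. These are the compressions of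
    the creation operators of a tensor product of full Fock spaces to a
    coinvariant subspace.

    Everything about them is diagonal. The adjoint of [T i j] removes the letter
    [j], so the map [Phi] of index [i] turns the projection onto a set of tuples
    into another such projection ([Phi_diag]). Hence every [Delta_pow p] of the
    identity is the projection onto the tuples whose words of index [i] with
    [p i] are empty ([Delta_pow_diag]), which is positive; the [m]-th iterate of
    [Phi] at the identity is the projection onto the tuples whose [i]-th word
    has length at least [m], which tends strongly to [0]; and the defect is the
    projection onto the line of the empty tuple, of rank one. Applying products
    of the [T i j] to the empty tuple reaches every tuple of [D], so [M_space q]
    has as a basis the tuples of [D] with words of lengths at most [q]
    ([has_dim_M_space]).

    The Euler characteristic is therefore the asymptotic density of [D]. It is
    prescribed in one coordinate: [D] consists of the tuples whose word of index
    [i0] is empty or, read as the base-[n i0] expansion of a number in [0, 1[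
    with its last letter as leading digit, smaller than [t] ([below]). The first
    letter is the least significant digit, whence the stability of [D]. On words
    of length [l] the count lies between [t * n i0 ^ l] and [t * n i0 ^ l + 1],
    and there are at least [(q i0 + 1) ^ 2 / 2] words of length at most [q i0],
    so the ratio for [q] differs from [t] by at most [2 / (q i0 + 1)]
    ([euler_ratio_bounds]).

    The Hilbert space is that of square summable families. Sums are limits along
    the net of finite subsets of the index set, which makes the reindexing
    behind the computation of adjoints immediate ([net_sum_transport],
    [inner_push]). *)

Set Implicit Arguments.
Unset Strict Implicit.
Unset Printing Implicit Defensive.

Import Order.TTheory GRing.Theory Num.Theory.
Import numFieldNormedType.Exports.
Import summability (totally, totally_filter).

Local Open Scope classical_set_scope.
Local Open Scope ring_scope.
Local Open Scope complex_scope.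

#[local] Existing Instance totally_filter.

(** * Unconditional summation of real families *)

Section Summation.
Variables (R : realType) (I : choiceType).
Implicit Types (a b : I -> R) (A B : {fset I}).

Definition psum a A : R := \sum_(i <- A) a i.

Definition bounded_psums a := exists M, forall A, psum a A <= M.

Definition abs_summable a := bounded_psums (fun i => `|a i|).

Definition net_sum a : R := lim (psum a @ totally).

Lemma psumD a b A : psum (fun i => a i + b i) A = psum a A + psum b A.
Proof. exact: big_split. Qed.

Lemma psumZ c a A : psum (fun i => c * a i) A = c * psum a A.
Proof. by rewrite /psum mulr_sumr. Qed.

Lemma ler_psum a b A : (forall i, a i <= b i) -> psum a A <= psum b A.
Proof. by move=> ab; apply: ler_sum => i _. Qed.

Lemma psum_ge0 a A : (forall i, 0 <= a i) -> 0 <= psum a A.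
Proof. by move=> a0; apply: sumr_ge0 => i _. Qed.

Lemma psum_restrict a A B : (A `<=` B)%fset ->
  psum a A = psum (fun i => if i \in A then a i else 0) B.
Proof.
move=> AB; rewrite /psum -(big_fset_incl _ AB) => [|i _ /negPf -> //].
by apply: eq_big_seq => i ->.
Qed.

Lemma psum_sub a A B : (forall i, 0 <= a i) -> (A `<=` B)%fset ->
  psum a A <= psum a B.
Proof.
by move=> a0 AB; rewrite (psum_restrict a AB); apply: ler_psum => i; case: ifP.
Qed.

Lemma near_totally_superset A : \forall B \near totally, (A `<=` B)%fset.
Proof. by exists A. Qed.

(** A nonnegative family with bounded finite sums has a monotone net of finite
    sums, which converges to its supremum. *)
Lemma cvg_psum_ge0 a : (forall i, 0 <= a i) -> bounded_psums a ->
  psum a @ totally --> sup (range (psum a)).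
Proof.
move=> a0 [M aM]; set E := range _.
have supE : has_sup E.
  by split; [exists (psum a fset0), fset0 | exists M => _ [A _ <-]].
apply/cvgrPdist_lt => e e0.
have [_ [A _ <-] Ae] := sup_adherent e0 supE.
apply: filterS (near_totally_superset A) => B AB.
have leB : psum a B <= sup E by apply: sup_upper_bound => //; exists B.
rewrite ger0_norm ?subr_ge0// ltrBlDr -ltrBlDl.
exact: lt_le_trans Ae (psum_sub a0 AB).
Qed.

Lemma abs_summable_le a b : (forall i, `|a i| <= b i) -> bounded_psums b ->
  abs_summable a.
Proof.
by move=> ab [M bM]; exists M => A; apply: le_trans (bM A); exact: ler_psum.
Qed.

Lemma bounded_psumsD a b : bounded_psums a -> bounded_psums b ->
  bounded_psums (fun i => a i + b i).
Proof.
by move=> [M aM] [N bN]; exists (M + N) => A; rewrite psumD lerD.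
Qed.

Lemma bounded_psumsZ c a : 0 <= c -> bounded_psums a ->
  bounded_psums (fun i => c * a i).
Proof. by move=> c0 [M aM]; exists (c * M) => A; rewrite psumZ ler_wpM2l. Qed.

Lemma ge0_abs_summable a : (forall i, 0 <= a i) -> bounded_psums a ->
  abs_summable a.
Proof. by move=> a0; apply: abs_summable_le => i; rewrite ger0_norm. Qed.

Lemma abs_summableZD c a b : abs_summable a -> abs_summable b ->
  abs_summable (fun i => c * a i + b i).
Proof.
move=> sa sb; apply: (@abs_summable_le _ (fun i => `|c| * `|a i| + `|b i|)).
  by move=> i; rewrite -normrM ler_normD.
by apply: bounded_psumsD sb; exact: bounded_psumsZ.
Qed.

(** The family is the difference of the nonnegative families [a + |a|] and
    [|a|], which reduces convergence to the monotone case. *)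
Lemma cvg_psum a : abs_summable a -> psum a @ totally --> net_sum a.
Proof.
move=> sa; apply: cvgP.
have a0 i : 0 <= a i + `|a i| by have := lerNnormlW (lexx `|a i|); lra.
have sb : bounded_psums (fun i => a i + `|a i|).
  case: (bounded_psumsD sa sa) => M aM; exists M => A.
  by apply: le_trans (aM A); apply: ler_psum => i; rewrite lerD2r ler_norm.
have -> : psum a =
    psum (fun i => a i + `|a i|) \- psum (fun i => `|a i|).
  by apply/funext => A /=; rewrite psumD addrK.
by apply: cvgB; apply: cvg_psum_ge0.
Qed.

Lemma net_sumE a l : psum a @ totally --> l -> net_sum a = l.
Proof. exact: cvg_lim. Qed.

Lemma net_sumZD c a b : abs_summable a -> abs_summable b ->
  net_sum (fun i => c * a i + b i) = c * net_sum a + net_sum b.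
Proof.
move=> sa sb; apply: net_sumE.
have -> : psum (fun i => c * a i + b i) = (fun A => c * psum a A + psum b A).
  by apply/funext => A; rewrite psumD psumZ.
by apply: cvgD; [apply: cvgMr; exact: cvg_psum | exact: cvg_psum].
Qed.

Lemma net_sum0 : net_sum (fun=> 0) = 0.
Proof.
apply: net_sumE; have -> : psum (fun=> 0) = cst 0; last exact: cvg_cst.
by apply/funext => A; rewrite /psum big1.
Qed.

Lemma net_sumZ c a : abs_summable a ->
  net_sum (fun i => c * a i) = c * net_sum a.
Proof.
move=> sa; have s0 : abs_summable (fun=> 0).
  by exists 0 => A; rewrite /psum big1// => i _; rewrite normr0.
rewrite -[RHS]addr0 -net_sum0 -net_sumZD//; congr net_sum.
by apply/funext => i; rewrite addr0.
Qed.

Lemma net_sumN a : abs_summable a -> net_sum (fun i => - a i) = - net_sum a.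
Proof.
move=> sa; rewrite -mulN1r -net_sumZ//; congr net_sum.
by apply/funext => i; rewrite mulN1r.
Qed.

Lemma net_sum_le a M : abs_summable a -> (forall A, psum a A <= M) ->
  net_sum a <= M.
Proof.
by move=> sa aM; apply: (limr_le (cvgP _ (cvg_psum sa))); exact: nearW.
Qed.

Lemma psum_le_net_sum a A : (forall i, 0 <= a i) -> bounded_psums a ->
  psum a A <= net_sum a.
Proof.
move=> a0 sa; apply: limr_ge; first exact: cvgP (cvg_psum_ge0 a0 sa).
by apply: filterS (near_totally_superset A) => B; exact: psum_sub.
Qed.

Lemma le_net_sum a b : (forall i, 0 <= a i <= b i) -> bounded_psums b ->
  net_sum a <= net_sum b.
Proof.
move=> ab sb; have a0 i : 0 <= a i by have /andP[] := ab i.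
have b0 i : 0 <= b i by have /andP[? ?] := ab i; exact: le_trans (a0 i) _.
apply: net_sum_le => [|A].
  by apply: abs_summable_le sb => i; rewrite ger0_norm//; have /andP[] := ab i.
apply: le_trans (psum_le_net_sum A b0 sb).
by apply: ler_psum => i; have /andP[] := ab i.
Qed.

Lemma net_sum_ge0 a : (forall i, 0 <= a i) -> bounded_psums a -> 0 <= net_sum a.
Proof.
by move=> a0 sa; apply: le_trans (psum_le_net_sum fset0 a0 sa); exact: psum_ge0.
Qed.

Lemma le_term_net_sum a i : (forall i, 0 <= a i) -> bounded_psums a ->
  a i <= net_sum a.
Proof.
move=> a0 sa; apply: le_trans (psum_le_net_sum [fset i]%fset a0 sa).
by rewrite /psum big_seq_fset1.
Qed.

(** Here [c] is an injection and [g] a left inverse of it, so that the equation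
    [c (g y) = y] recognises the image of [c]. *)
Definition transport (c g : I -> I) a : I -> R :=
  fun y => if c (g y) == y then a (g y) else 0.

Lemma psum_transport (c g : I -> I) a A : cancel c g ->
  psum (transport c g a) A =
  psum a [fset g y | y in [fset y in A | c (g y) == y]]%fset.
Proof.
move=> cg; rewrite /psum big_imfset/=; last first.
  move=> x y; rewrite !inE => /andP[_ /eqP xE] /andP[_ /eqP yE] gxy.
  by rewrite -xE gxy.
have sub : ([fset y in A | c (g y) == y] `<=` A)%fset by exact: fset_sub.
rewrite -(big_fset_incl _ sub) => [|y yA]; last first.
  by rewrite !inE/= yA /= /transport => /negPf ->.
by apply: eq_big_seq => y; rewrite !inE/= /transport => /andP[_ ->].
Qed.

Lemma bounded_psums_transport (c g : I -> I) a : cancel c g ->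
  bounded_psums a -> bounded_psums (transport c g a).
Proof. by move=> cg [M aM]; exists M => A; rewrite psum_transport. Qed.

Lemma bounded_psums_comp (c g : I -> I) a : cancel c g ->
  bounded_psums a -> bounded_psums (a \o c).
Proof.
move=> cg [M aM]; exists M => A; apply: le_trans (aM (c @` A)%fset).
by rewrite /psum big_imfset//= => x y _ _; exact: can_inj cg x y.
Qed.

(** The net of finite subsets sees no enumeration: taking preimages under [c] is
    cofinal among finite subsets, which is all that the limit needs. *)
Lemma net_sum_transport (c g : I -> I) a : cancel c g -> abs_summable a ->
  net_sum (transport c g a) = net_sum a.
Proof.
move=> cg sa; apply: net_sumE.
set h := fun A : {fset I} =>
  [fset g y | y in [fset y in A | c (g y) == y]]%fset.
have -> : psum (transport c g a) = psum a \o h.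
  by apply/funext => A; rewrite psum_transport.
apply: cvg_comp (cvg_psum sa) => P [A _ AP].
exists (c @` A)%fset => // B /= /fsubsetP AB; apply: AP => /=.
apply/fsubsetP => x xA; apply/imfsetP; exists (c x) => /=; last by rewrite cg.
by rewrite !inE/= cg eqxx andbT AB// in_imfset.
Qed.

End Summation.

(** * The Hilbert space of square summable families *)

Section SquareModulus.
Variable R : realType.
Implicit Types z w : R[i].

Definition sqmod z : R := complex.Re z ^+ 2 + complex.Im z ^+ 2.

Lemma sqmod_ge0 z : 0 <= sqmod z.
Proof. by rewrite addr_ge0 ?sqr_ge0. Qed.

Lemma sqmod0 : sqmod 0 = 0.
Proof. by rewrite /sqmod /= expr0n addr0. Qed.

Lemma sqmodM z w : sqmod (z * w) = sqmod z * sqmod w.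
Proof. by case: z w => [a b] [c d]; rewrite /sqmod/=; ring. Qed.

Lemma sqmod_eq0 z : sqmod z = 0 -> z = 0.
Proof.
case: z => a b; rewrite /sqmod/= => /eqP; rewrite paddr_eq0 ?sqr_ge0//.
by rewrite !sqrf_eq0 => /andP[/eqP -> /eqP ->].
Qed.

(** The difference of the two sides is a square divided by [s]. The weight [s]
    is free, so the bound can be summed over a family first and optimised in [s]
    afterwards, which yields the triangle inequality for the norm. *)
Lemma sqmodD_le s z w : 0 < s ->
  sqmod (z + w) <= (1 + s) * sqmod z + (1 + s^-1) * sqmod w.
Proof.
case: z w => [a b] [c d] s0; rewrite /sqmod/= -subr_ge0.
have -> : (1 + s) * (a ^+ 2 + b ^+ 2) + (1 + s^-1) * (c ^+ 2 + d ^+ 2) -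
    ((a + c) ^+ 2 + (b + d) ^+ 2) =
    s^-1 * ((s * a - c) ^+ 2 + (s * b - d) ^+ 2).
  by field; rewrite gt_eqF.
apply: mulr_ge0; first by rewrite invr_ge0 ltW.
by rewrite addr_ge0 ?sqr_ge0.
Qed.

Lemma normcE_sqmod z : `|z| = (Num.sqrt (sqmod z))%:C.
Proof. exact: normc_def. Qed.

End SquareModulus.

Section L2.
Variables (R : realType) (I : choiceType) (D : pred I).
Implicit Types f g h : I -> R[i].

Definition square_summable f := bounded_psums (fun i => sqmod (f i)).

(** Families supported in [D]: the parameter gives all coordinate subspaces of
    one sequence space, without changing the index type. *)
Definition l2pred : {pred I -> R[i]} :=
  fun f => `[< square_summable f /\ forall i, ~~ D i -> f i = 0 >].

Lemma l2predP f :
  reflect (square_summable f /\ forall i, ~~ D i -> f i = 0) (f \in l2pred).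
Proof. exact: asboolP. Qed.

Lemma square_summableZD (c : R[i]) f g :
  square_summable f -> square_summable g ->
  square_summable (fun i => c * f i + g i).
Proof.
move=> sf sg.
have [M hM] : bounded_psums
    (fun i => (2 * sqmod c) * sqmod (f i) + 2 * sqmod (g i)).
  by apply: bounded_psumsD; apply: bounded_psumsZ => //;
    rewrite mulr_ge0 ?sqmod_ge0.
exists M => A; apply: le_trans (hM A); apply: ler_psum => i.
have := sqmodD_le (c * f i) (g i) (@ltr01 R).
by rewrite invr1 sqmodM -mulrA.
Qed.

Lemma l2pred_submod : submod_closed l2pred.
Proof.
split=> [|c f g /l2predP[sf f0] /l2predP[sg g0]]; apply/l2predP; split => //.
- by exists 0 => A; rewrite /psum big1// => i _; exact: sqmod0.
- exact: square_summableZD.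
- by move=> i Di; rewrite [LHS](_ : _ = c * f i + g i)// f0// g0// mulr0 addr0.
Qed.

HB.instance Definition _ :=
  GRing.isSubmodClosed.Build R[i] (I -> R[i]) l2pred l2pred_submod.

Record ell2 := Ell2 { ell2_val :> I -> R[i]; _ : ell2_val \in l2pred }.

HB.instance Definition _ := [isSub for ell2_val].
HB.instance Definition _ := [Choice of ell2 by <:].
HB.instance Definition _ := [SubChoice_isSubLmodule of ell2 by <:].

Implicit Types x y : ell2.

Lemma ell2P x y : (forall i, x i = y i) -> x = y.
Proof. by move=> xy; apply/val_inj/funext. Qed.

Lemma ell2_sum x : square_summable x.
Proof. by case: x => f /= /l2predP[]. Qed.

Lemma ell2_supp x i : ~~ D i -> x i = 0.
Proof. by case: x => f /= /l2predP[_]; apply. Qed.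

Lemma ell2D x y i : (x + y) i = x i + y i. Proof. by []. Qed.

Lemma ell2N x i : (- x) i = - x i. Proof. by []. Qed.

Lemma ell2Z (c : R[i]) x i : (c *: x) i = c * x i. Proof. by []. Qed.

Lemma ell2_0 i : (0 : ell2) i = 0. Proof. by []. Qed.

Lemma ell2_sumE n (F : 'I_n -> ell2) i : (\sum_j F j) i = \sum_j F j i.
Proof.
elim: n F => [|n IH] F; first by rewrite !big_ord0.
by rewrite !big_ord_recl ell2D IH.
Qed.

Definition sqnorm x : R := net_sum (fun i => sqmod (x i)).

Lemma sqnorm_ge0 x : 0 <= sqnorm x.
Proof. by apply: net_sum_ge0 => [i|]; [exact: sqmod_ge0 | exact: ell2_sum]. Qed.

Lemma le_sqnorm x i : sqmod (x i) <= sqnorm x.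
Proof.
by apply: (le_term_net_sum i) => [j|]; [exact: sqmod_ge0 | exact: ell2_sum].
Qed.

Lemma psum_le_sqnorm x A : psum (fun i => sqmod (x i)) A <= sqnorm x.
Proof.
by apply: psum_le_net_sum => [i|]; [exact: sqmod_ge0 | exact: ell2_sum].
Qed.

Lemma sqnorm_le x M : (forall A, psum (fun i => sqmod (x i)) A <= M) ->
  sqnorm x <= M.
Proof.
apply: net_sum_le; apply: ge0_abs_summable => [i|]; first exact: sqmod_ge0.
exact: ell2_sum.
Qed.

Lemma sqnorm_eq0 x : sqnorm x = 0 -> x = 0.
Proof.
move=> x0; apply: ell2P => i; apply: sqmod_eq0; apply/le_anti.
by rewrite sqmod_ge0 -x0 le_sqnorm.
Qed.

Lemma sqnormZ (c : R[i]) x : sqnorm (c *: x) = sqmod c * sqnorm x.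
Proof.
rewrite -[RHS]net_sumZ.
  by congr net_sum; apply/funext => i; rewrite ell2Z sqmodM.
by apply: ge0_abs_summable => [i|]; [exact: sqmod_ge0 | exact: ell2_sum].
Qed.

Lemma sqnormD_le s x y : 0 < s ->
  sqnorm (x + y) <= (1 + s) * sqnorm x + (1 + s^-1) * sqnorm y.
Proof.
move=> s0; apply: sqnorm_le => A.
apply: (@le_trans _ _ (psum (fun i => (1 + s) * sqmod (x i) +
    (1 + s^-1) * sqmod (y i)) A)).
  by apply: ler_psum => i; exact: sqmodD_le.
by rewrite psumD !psumZ; apply: lerD; apply: ler_wpM2l;
  rewrite ?addr_ge0 ?invr_ge0 ?psum_le_sqnorm// ltW.
Qed.

Definition ell2_norm x : R[i] := (Num.sqrt (sqnorm x))%:C.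

(** The choice [s = Y / X] of the weight, for [X] and [Y] the two norms,
    turns the weighted bound on the square of the left side into
    [(X + Y) ^+ 2]. *)
Lemma ell2_normD x y : ell2_norm (x + y) <= ell2_norm x + ell2_norm y.
Proof.
rewrite /ell2_norm -rmorphD/= lecR.
have [->|xn0] := eqVneq x 0; first by rewrite add0r lerDr sqrtr_ge0.
have [->|yn0] := eqVneq y 0; first by rewrite addr0 lerDl sqrtr_ge0.
have pos z : z != 0 -> 0 < Num.sqrt (sqnorm z).
  move=> zn0; rewrite sqrtr_gt0 lt_neqAle sqnorm_ge0 andbT eq_sym.
  by apply: contraNneq zn0 => /sqnorm_eq0 ->.
have X2 := sqr_sqrtr (sqnorm_ge0 x); have Y2 := sqr_sqrtr (sqnorm_ge0 y).
move: (pos x xn0) (pos y yn0) X2 Y2.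
set X := Num.sqrt (sqnorm x); set Y := Num.sqrt (sqnorm y) => X0 Y0 X2 Y2.
rewrite -(ler_pXn2r (ltn0Sn 1)) ?nnegrE ?sqrtr_ge0 ?addr_ge0
  ?(ltW X0) ?(ltW Y0)//.
rewrite sqr_sqrtr ?sqnorm_ge0//.
apply: le_trans (sqnormD_le x y (divr_gt0 Y0 X0)) _.
rewrite -X2 -Y2 invf_div le_eqVlt; apply/orP; left; apply/eqP.
by field; rewrite !gt_eqF.
Qed.

Lemma ell2_normZ (c : R[i]) x : ell2_norm (c *: x) = `|c| * ell2_norm x.
Proof.
by rewrite /ell2_norm sqnormZ sqrtrM ?sqmod_ge0// rmorphM normcE_sqmod.
Qed.

Lemma ell2_norm_eq0 x : ell2_norm x = 0 -> x = 0.
Proof.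
move=> /complexI/eqP; rewrite sqrtr_eq0 => x0; apply: sqnorm_eq0.
by apply/le_anti; rewrite x0 sqnorm_ge0.
Qed.

HB.instance Definition _ := Lmodule_isNormed.Build R[i] ell2
  ell2_normD ell2_normZ ell2_norm_eq0.

Lemma ell2_normE x : `|x| = (Num.sqrt (sqnorm x))%:C.
Proof. by []. Qed.

Lemma ell2_norm_lt x (r : R) : 0 < r -> (`|x| < r%:C) = (sqnorm x < r ^+ 2).
Proof.
move=> r0; rewrite ell2_normE ltcR -(ltr_pXn2r (ltn0Sn 1)) ?nnegrE ?sqrtr_ge0//.
  by rewrite sqr_sqrtr ?sqnorm_ge0.
exact: ltW.
Qed.

Lemma ell2_norm_le x (r : R) : 0 <= r -> (`|x| <= r%:C) = (sqnorm x <= r ^+ 2).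
Proof.
move=> r0; rewrite ell2_normE lecR -(ler_pXn2r (ltn0Sn 1)) ?nnegrE ?sqrtr_ge0//.
by rewrite sqr_sqrtr ?sqnorm_ge0.
Qed.

End L2.

Section Completeness.
Variables (R : realType) (I : choiceType) (D : pred I).
Local Notation H := (ell2 R D).

Lemma Re_le_sqmod (z : R[i]) (r : R) : 0 <= r -> sqmod z <= r ^+ 2 ->
  `|complex.Re z| <= r.
Proof.
move=> r0 zr; rewrite -(ler_pXn2r (ltn0Sn 1)) ?nnegrE// real_normK ?num_real//.
by apply: le_trans zr; rewrite lerDl sqr_ge0.
Qed.

Lemma Im_le_sqmod (z : R[i]) (r : R) : 0 <= r -> sqmod z <= r ^+ 2 ->
  `|complex.Im z| <= r.
Proof.
move=> r0 zr; rewrite -(ler_pXn2r (ltn0Sn 1)) ?nnegrE// real_normK ?num_real//.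
by apply: le_trans zr; rewrite lerDr sqr_ge0.
Qed.

Lemma ReB (z w : R[i]) : complex.Re (z - w) = complex.Re z - complex.Re w.
Proof. by case: z w => [? ?] [? ?]. Qed.

Lemma ImB (z w : R[i]) : complex.Im (z - w) = complex.Im z - complex.Im w.
Proof. by case: z w => [? ?] [? ?]. Qed.

Lemma cauchy_ell2 (F : set_system H) : ProperFilter F -> cauchy F ->
  forall r : R, 0 < r ->
  exists x : H, \forall y \near F, sqnorm (x - y) < r ^+ 2.
Proof.
move=> FF /cauchyP Fc r r0.
have [|x xF] := Fc r%:C; first by rewrite ltcR.
exists x; apply: filterS xF => y; rewrite -ball_normE /ball_/=.
by rewrite ell2_norm_lt.
Qed.

(** Coordinates are taken through a map [p], which is the real or the imaginary
    part, so that the limit is found in the complete space [R]. *)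
Lemma cauchy_coordinate (F : set_system H) (p : R[i] -> R) :
    (forall z w, p (z - w) = p z - p w) ->
    (forall z r, 0 <= r -> sqmod z <= r ^+ 2 -> `|p z| <= r) ->
  ProperFilter F -> cauchy F -> forall i, cvg ((fun x : H => p (x i)) @ F).
Proof.
move=> pB ple FF Fc i; apply: cauchy_cvg; apply/cauchyP => e e0.
have [|x xF] := cauchy_ell2 FF Fc (r := e / 2); first by rewrite divr_gt0.
exists (p (x i)); rewrite /fmap /nbhs/=.
apply: filterS xF => y xy; rewrite /= -ball_normE /ball_/=.
apply: (@le_lt_trans _ _ (e / 2)); last first.
  by rewrite ltr_pdivrMr// ltr_pMr// ltr1n.
rewrite -pB; apply: ple; first by rewrite divr_ge0// ltW.
by apply: le_trans (ltW xy); exact: (le_sqnorm (x - y) i).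
Qed.

(** The coordinatewise limit of a Cauchy filter is a limit in norm: a bound on
    the finite partial sums of the squared distance passes to the limit. *)
Lemma ell2_complete (F : set_system H) : ProperFilter F -> cauchy F -> cvg F.
Proof.
move=> FF Fc.
have cRe i := cauchy_coordinate ReB Re_le_sqmod FF Fc (i := i).
have cIm i := cauchy_coordinate ImB Im_le_sqmod FF Fc (i := i).
pose g i : R[i] := lim ((fun x : H => complex.Re (x i)) @ F) +i*
                   lim ((fun x : H => complex.Im (x i)) @ F).
have limit_bound (x : H) (r : R) :
    (\forall y \near F, sqnorm (x - y) < r ^+ 2) ->
    forall A, psum (fun i => sqmod (x i - g i)) A <= r ^+ 2.
  move=> xF A.
  have cvgA : psum (fun i => sqmod (x i - (y : H) i)) A @[y --> F] -->
      psum (fun i => sqmod (x i - g i)) A.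
    apply: (cvg_big (op := +%R) add_continuous) => i _; rewrite /sqmod.
    have -> : complex.Re (x i - g i) =
        complex.Re (x i) - lim ((fun x : H => complex.Re (x i)) @ F).
      by rewrite ReB.
    have -> : complex.Im (x i - g i) =
        complex.Im (x i) - lim ((fun x : H => complex.Im (x i)) @ F).
      by rewrite ImB.
    under eq_fun do rewrite ReB ImB !expr2.
    rewrite !expr2; apply: cvgD; apply: cvgM;
      apply: cvgB; solve [exact: cvg_cst | exact: cRe | exact: cIm].
  rewrite -(cvg_lim _ cvgA)//; apply: limr_le; first exact: cvgP cvgA.
  apply: filterS xF => y /ltW; apply: le_trans.
  exact: (psum_le_sqnorm (x - y)).
have [|x0 x0F] := cauchy_ell2 FF Fc (r := 1) => //.
have gl2 : g \in l2pred D.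
  apply/l2predP; split; last first.
    move=> i Di; rewrite /g.
    have -> : (fun x : H => complex.Re (x i)) = cst 0.
      by apply/funext => x; rewrite ell2_supp.
    have -> : (fun x : H => complex.Im (x i)) = cst 0.
      by apply/funext => x; rewrite ell2_supp.
    by rewrite !lim_cst.
  have -> : g = fun i => -1 * (x0 i - g i) + x0 i.
    by apply/funext => i; rewrite mulN1r opprB subrK.
  apply: square_summableZD; last exact: ell2_sum.
  by exists (1 ^+ 2); exact: limit_bound.
apply/cvg_ex; exists (Ell2 gl2); apply/cvgrPdist_lt => e e0.
have eE : e = (complex.Re e)%:C by rewrite RRe_real// gtr0_real.
have r0 : 0 < complex.Re e by rewrite eE ltcR in e0.
have r20 : 0 < complex.Re e / 2 by rewrite divr_gt0.
have [x xF] := cauchy_ell2 FF Fc r20.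
apply: filterS (xF) => y xy.
rewrite -(subrKA x) eE [in ltRHS](splitr (complex.Re e)) rmorphD/=.
apply: le_lt_trans (ler_normD _ _) _; apply: ler_ltD.
  rewrite -normrN opprB ell2_norm_le; last exact: ltW.
  by apply: sqnorm_le => A; exact: limit_bound.
by rewrite ell2_norm_lt.
Qed.

HB.instance Definition _ := Uniform_isComplete.Build H ell2_complete.

End Completeness.


Section InnerProduct.
Variables (R : realType) (I : choiceType) (D : pred I).
Local Notation H := (ell2 R D).
Implicit Types (x y z : H).

(** Real and imaginary part of the product of [z] by the conjugate of [w]. *)
Definition re_prod (z w : R[i]) : R :=
  complex.Re z * complex.Re w + complex.Im z * complex.Im w.

Definition im_prod (z w : R[i]) : R :=
  complex.Im z * complex.Re w - complex.Re z * complex.Im w.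

Definition ell2_inner x y : R[i] :=
  net_sum (fun i => re_prod (x i) (y i)) +i*
  net_sum (fun i => im_prod (x i) (y i)).

Lemma normr_re_prod_le (z w : R[i]) : `|re_prod z w| <= sqmod z + sqmod w.
Proof.
case: z w => [a b] [c d]; rewrite /re_prod/sqmod/= ler_norml.
have := (sqr_ge0 a, sqr_ge0 b, sqr_ge0 c, sqr_ge0 d).
have := (sqr_ge0 (a + c), sqr_ge0 (b + d), sqr_ge0 (a - c), sqr_ge0 (b - d)).
rewrite !expr2 => -[[[? ?] ?] ?] [[[? ?] ?] ?].
by apply/andP; split; lra.
Qed.

Lemma normr_im_prod_le (z w : R[i]) : `|im_prod z w| <= sqmod z + sqmod w.
Proof.
case: z w => [a b] [c d]; rewrite /im_prod/sqmod/= ler_norml.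
have := (sqr_ge0 a, sqr_ge0 b, sqr_ge0 c, sqr_ge0 d).
have := (sqr_ge0 (b + c), sqr_ge0 (a + d), sqr_ge0 (b - c), sqr_ge0 (a - d)).
rewrite !expr2 => -[[[? ?] ?] ?] [[[? ?] ?] ?].
by apply/andP; split; lra.
Qed.

Lemma re_prod_summable x y : abs_summable (fun i => re_prod (x i) (y i)).
Proof.
apply: abs_summable_le (fun i => normr_re_prod_le _ _) _.
by apply: bounded_psumsD; exact: ell2_sum.
Qed.

Lemma im_prod_summable x y : abs_summable (fun i => im_prod (x i) (y i)).
Proof.
apply: abs_summable_le (fun i => normr_im_prod_le _ _) _.
by apply: bounded_psumsD; exact: ell2_sum.
Qed.

Lemma ell2_inner_linear (c : R[i]) x y z :
  ell2_inner (c *: x + y) z = c * ell2_inner x z + ell2_inner y z.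
Proof.
have sr := re_prod_summable x z; have si := im_prod_summable x z.
have tr := re_prod_summable y z; have ti := im_prod_summable y z.
apply/eqP; rewrite eq_complex /ell2_inner; apply/andP; split; apply/eqP.
- transitivity (net_sum (fun i => complex.Re c * re_prod (x i) (z i) +
    (- complex.Im c * im_prod (x i) (z i) + re_prod (y i) (z i)))).
    congr net_sum; apply/funext => i; rewrite ell2D ell2Z /re_prod /im_prod.
    by case: c (x i) (y i) (z i) => [? ?] [? ?] [? ?] [? ?] /=; ring.
  rewrite !net_sumZD//; last exact: abs_summableZD.
  by case: c => ? ? /=; ring.
- transitivity (net_sum (fun i => complex.Re c * im_prod (x i) (z i) +
    (complex.Im c * re_prod (x i) (z i) + im_prod (y i) (z i)))).
    congr net_sum; apply/funext => i; rewrite ell2D ell2Z /re_prod /im_prod.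
    by case: c (x i) (y i) (z i) => [? ?] [? ?] [? ?] [? ?] /=; ring.
  rewrite !net_sumZD//; last exact: abs_summableZD.
  by case: c => ? ? /=; ring.
Qed.

Lemma ell2_inner_sym x y : ell2_inner x y = (ell2_inner y x)^*.
Proof.
apply/eqP; rewrite eq_complex; apply/andP; split; apply/eqP; rewrite /=.
  by congr net_sum; apply/funext => i; rewrite /re_prod; ring.
rewrite -net_sumN; last exact: im_prod_summable.
by congr net_sum; apply/funext => i; rewrite /im_prod; ring.
Qed.

Lemma ell2_inner_xx x : ell2_inner x x = (sqnorm x)%:C.
Proof.
apply/eqP; rewrite eq_complex; apply/andP; split; apply/eqP; rewrite /=.
  by congr net_sum; apply/funext => i; rewrite /re_prod /sqmod !expr2.
rewrite -[RHS](net_sum0 R I); congr net_sum; apply/funext => i.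
by rewrite /im_prod; ring.
Qed.

Let innerDl x y z : ell2_inner (x + y) z = ell2_inner x z + ell2_inner y z.
Proof. by rewrite -[x in LHS]scale1r ell2_inner_linear mul1r. Qed.

Let inner0l z : ell2_inner 0 z = 0.
Proof. by apply: (addIr (ell2_inner 0 z)); rewrite -innerDl !add0r. Qed.

Let innerZl (c : R[i]) x z : ell2_inner (c *: x) z = c * ell2_inner x z.
Proof. by rewrite -[c *: x]addr0 ell2_inner_linear inner0l addr0. Qed.

Let innerBl z : zmod_morphism (ell2_inner^~ z).
Proof. by move=> x y; rewrite /= innerDl -scaleN1r innerZl mulN1r. Qed.

Let innerBr z : zmod_morphism (ell2_inner z).
Proof.
move=> x y; rewrite ell2_inner_sym innerBl.
rewrite [in RHS]ell2_inner_sym [ell2_inner z y]ell2_inner_sym.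
exact: rmorphB.
Qed.

Let innerZr z : scalable_for (@Num.conj R[i] \; *%R) (ell2_inner z).
Proof.
move=> c x; rewrite ell2_inner_sym innerZl [in RHS]ell2_inner_sym.
exact: rmorphM.
Qed.

HB.instance Definition _ := isBilinear.Build R[i] H H R[i]
  *%R (@Num.conj R[i] \; *%R) ell2_inner innerBl innerBr
  (fun z c x => innerZl c x z) innerZr.

Let inner_herm x y : ell2_inner x y = (-1) ^+ false * Num.conj (ell2_inner y x).
Proof. by rewrite mul1r ell2_inner_sym. Qed.

HB.instance Definition _ := isHermitianSesquilinear.Build R[i] H
  false (@Num.conj R[i]) ell2_inner inner_herm.

Let inner_pos x : x != 0 -> 0 < ell2_inner x x.
Proof.
move=> x0; rewrite ell2_inner_xx ltcR lt_neqAle sqnorm_ge0 andbT eq_sym.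
by apply: contraNneq x0 => /sqnorm_eq0 ->.
Qed.

HB.instance Definition _ := isDotProduct.Build R[i] H ell2_inner inner_pos.

Let norm_inner x : `|x| ^+ 2 = ell2_inner x x.
Proof.
by rewrite ell2_normE ell2_inner_xx -rmorphXn/= sqr_sqrtr// sqnorm_ge0.
Qed.

Definition ell2_hilbert : hilbertType R :=
  @Hilbert R H ell2_inner norm_inner.

End InnerProduct.

(** * Shifts and diagonal projections *)

Section Adjoint.
Variables (R : realType) (H : hilbertType R).

(** A formal adjoint is the adjoint, because the inner product separates
    points. *)
Lemma adjointE (A B : H -> H) :
  (forall x y, inner (A x) y = inner x (B y)) -> adjoint A = B.
Proof.
move=> AB; apply/funext => y; rewrite /adjoint.
have ByP : [set z | forall x, inner (A x) y = inner x z] (B y).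
  by move=> x; exact: AB.
have := xgetI 0 ByP; set z := xget _ _ => zP.
apply/eqP; rewrite -subr_eq0 -(dnorm_eq0 inner); apply/eqP.
by rewrite linearBr/= -zP AB subrr.
Qed.

End Adjoint.

Section Shift.
Variables (R : realType) (I : choiceType) (D : pred I).
Local Notation H := (ell2 R D).
Implicit Types x y : H.

Lemma dominated_l2pred (f : I -> R[i]) (b : I -> R) : bounded_psums b ->
  (forall i, sqmod (f i) <= b i) -> (forall i, ~~ D i -> f i = 0) ->
  f \in l2pred D.
Proof.
move=> [M bM] fb f0; apply/l2predP; split=> //; exists M => A.
by apply: le_trans (bM A); exact: ler_psum.
Qed.

Section Diagonal.
Variable d : pred I.

Lemma diag_l2 x : (fun i => if d i then x i else 0) \in l2pred D.
Proof.
apply: (dominated_l2pred (ell2_sum x)) => i.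
  by case: ifP; rewrite // sqmod0 sqmod_ge0.
by move=> /ell2_supp ->; rewrite if_same.
Qed.

Definition diag x : H := Ell2 (diag_l2 x).

Lemma diagE x i : diag x i = if d i then x i else 0. Proof. by []. Qed.

Lemma inner_diag_ge0 x : 0 <= ell2_inner (diag x) x.
Proof.
suff -> : ell2_inner (diag x) x = ell2_inner (diag x) (diag x).
  by rewrite ell2_inner_xx ler0c sqnorm_ge0.
by congr (_ +i* _); congr net_sum; apply/funext => i; rewrite diagE;
  case: ifP => // _; rewrite /re_prod /im_prod /= !mul0r.
Qed.

End Diagonal.

Lemma eq_diag d1 d2 : d1 =1 d2 -> diag d1 = diag d2.
Proof.
by move=> d12; apply/funext => x; apply: ell2P => i; rewrite !diagE d12.
Qed.

Lemma diagT : diag predT = idfun.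
Proof. by apply/funext => x; apply: ell2P => i; rewrite diagE. Qed.

Variables (c g : I -> I) (cg : cancel c g).

Lemma push_l2 x :
  (fun i => if (c (g i) == i) && D i then x (g i) else 0) \in l2pred D.
Proof.
apply: (dominated_l2pred (bounded_psums_transport cg (ell2_sum x))) => i.
  rewrite /transport; case: eqP => _ /=; last by rewrite sqmod0.
  by case: ifP; rewrite // sqmod0 sqmod_ge0.
by move=> /negPf ->; rewrite andbF.
Qed.

(** The compression to [D] of the isometry sending the basis vector at [i] to
    the one at [c i]. *)
Definition push x : H := Ell2 (push_l2 x).

Lemma pushE x i : push x i = if (c (g i) == i) && D i then x (g i) else 0.
Proof. by []. Qed.

Lemma pull_l2 x : (fun i => if D i then x (c i) else 0) \in l2pred D.
Proof.
apply: (dominated_l2pred (bounded_psums_comp cg (ell2_sum x))) => i.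
  by case: ifP; rewrite // sqmod0 sqmod_ge0.
by move=> /negPf ->.
Qed.

Definition pull x : H := Ell2 (pull_l2 x).

Lemma pullE x i : pull x i = if D i then x (c i) else 0.
Proof. by []. Qed.

Lemma push_linear : linear push.
Proof.
move=> a x y; apply: ell2P => i; rewrite ell2D ell2Z !pushE.
by case: ifP; rewrite // mulr0 addr0.
Qed.

Lemma push_bounded x : `|push x| <= `|x|.
Proof.
rewrite !ell2_normE lecR ler_sqrt ?sqnorm_ge0// /sqnorm.
have sx : square_summable x := ell2_sum x.
rewrite -[leRHS](net_sum_transport cg); last first.
  by apply: ge0_abs_summable => // i; exact: sqmod_ge0.
apply: le_net_sum; last exact: bounded_psums_transport.
move=> i; rewrite sqmod_ge0 pushE /transport/=.
by case: eqP => _ /=; [case: ifP; rewrite // sqmod0 sqmod_ge0 | rewrite sqmod0].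
Qed.

(** Both sides are sums of the same terms, indexed by the image of [c] on the
    left and by its source on the right; the conditions on [D] drop out
    because [x] and [y] already vanish outside [D]. *)
Lemma inner_push x y : ell2_inner (push x) y = ell2_inner x (pull y).
Proof.
have term (p : R[i] -> R[i] -> R) i :
    (forall z, p 0 z = 0) -> (forall z, p z 0 = 0) ->
    p (push x i) (y i) = transport c g (fun j => p (x j) (pull y j)) i.
  move=> p0 p0'; rewrite pushE /transport pullE; case: eqP => [->|_ /=] //=.
  have [Di|/ell2_supp ->] := boolP (D i); last by rewrite p0 if_same !p0'.
  by case: ifPn => // /ell2_supp ->; rewrite !p0.
congr (_ +i* _).
- rewrite -[RHS](net_sum_transport cg (re_prod_summable _ _)).
  congr net_sum; apply/funext => i.
  by apply: term => z; rewrite /re_prod/= ?(mul0r, mulr0) addr0.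
- rewrite -[RHS](net_sum_transport cg (im_prod_summable _ _)).
  congr net_sum; apply/funext => i.
  by apply: term => z; rewrite /im_prod/= ?(mul0r, mulr0) subr0.
Qed.

End Shift.

Arguments diag : simpl never.
Arguments push : simpl never.
Arguments pull : simpl never.

Section HilbertShift.
Variables (R : realType) (I : choiceType) (D : pred I).
Local Notation H := (ell2_hilbert R D).

Lemma adjoint_push (c g : I -> I) (cg : cancel c g) :
  adjoint (push cg : H -> H) = pull cg.
Proof. by apply: adjointE => x y; exact: inner_push. Qed.

Lemma push_bounded_operator (c g : I -> I) (cg : cancel c g) :
  bounded_operator (push cg : H -> H).
Proof.
split; first exact: push_linear.
by exists 1 => x; rewrite mul1r; exact: push_bounded.
Qed.

End HilbertShift.

(** * Compressed creation operators on tuples of words *)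

Section Words.
Variables (k : nat) (n : 'I_k -> nat).

Definition words := forall i : 'I_k, seq 'I_(n i).


Implicit Types w : words.

Lemma wordsP w w' : (forall i, w i = w' i) -> w = w'.
Proof. exact: functional_extensionality_dep. Qed.

Definition cons_at i (j : 'I_(n i)) w : words := eqtype.dfwith w (j :: w i).

Definition tail_at i w : words := eqtype.dfwith w (behead (w i)).

Definition empty_words : words := fun=> [::].

Lemma cons_at_in i (j : 'I_(n i)) w : cons_at j w i = j :: w i.
Proof. exact: eqtype.dfwith_in. Qed.

Lemma cons_at_out i (j : 'I_(n i)) w l : i != l -> cons_at j w l = w l.
Proof. exact: eqtype.dfwith_out. Qed.

Lemma tail_at_in i w : tail_at i w i = behead (w i).
Proof. exact: eqtype.dfwith_in. Qed.

Lemma tail_at_out i w l : i != l -> tail_at i w l = w l.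
Proof. exact: eqtype.dfwith_out. Qed.

Lemma cons_atK i (j : 'I_(n i)) : cancel (cons_at j) (tail_at i).
Proof.
move=> w; apply: wordsP => l; have [<-|il] := eqVneq i l.
  by rewrite tail_at_in cons_at_in.
by rewrite tail_at_out// cons_at_out.
Qed.

Lemma cons_tail_at i (j : 'I_(n i)) w :
  (cons_at j (tail_at i w) == w) = (ohead (w i) == Some j).
Proof.
apply/eqP/eqP => [<-|]; first by rewrite cons_at_in.
case wi : (w i) => [//|j' a] /= [jj']; apply: wordsP => l.
have [<-|il] := eqVneq i l; first by rewrite cons_at_in tail_at_in wi jj'.
by rewrite cons_at_out// tail_at_out.
Qed.

Lemma tail_atC s t w : tail_at s (tail_at t w) = tail_at t (tail_at s w).
Proof.
have [->//|st] := eqVneq s t; apply: wordsP => l.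
have [<-|sl] := eqVneq s l.
  by rewrite !(tail_at_in, tail_at_out) // eq_sym.
have [<-|tl] := eqVneq t l; first by rewrite !(tail_at_in, tail_at_out).
by rewrite !tail_at_out.
Qed.

End Words.

Section CompressedShifts.
Variables (R : realType) (k : nat) (n : 'I_k -> nat).
Local Notation W := (words n).
Variable D : pred W.
Hypothesis D_tail : forall i w, D w -> D (tail_at i w).
Local Notation H := (ell2_hilbert R D).

Definition wshift (i : 'I_k) (j : 'I_(n i)) : H -> H := push (cons_atK j).

Lemma wshiftE i (j : 'I_(n i)) (x : ell2 R D) w :
  (wshift j x : ell2 R D) w =
  if (ohead (w i) == Some j) && D w then x (tail_at i w) else 0.
Proof. by rewrite -cons_tail_at. Qed.

Lemma wshift_cross_commuting : cross_commuting (@wshift).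
Proof.
move=> s t a b st; apply/funext => x /=; apply: ell2P => w; rewrite !wshiftE.
rewrite tail_at_out// tail_at_out 1?eq_sym// tail_atC.
case: (boolP (D w)) => [Dw|_]; last by rewrite !andbF.
by rewrite !D_tail// !andbT; do 2!case: ifP.
Qed.

(** At a tuple [w] the only creation operator that contributes is the one of the
    first letter of [w i]; if [w i] is empty there is none. *)
Lemma Phi_diag i (d : pred W) :
  Phi (@wshift i) (diag d : H -> H) =
  diag (fun w => (w i != [::]) && d (tail_at i w)).
Proof.
apply/funext => x; apply: ell2P => w; rewrite /Phi ell2_sumE diagE.
under eq_bigr => j _ do
  rewrite adjoint_push wshiftE diagE pullE.
case: (boolP (D w)) => [Dw|Dw]; last first.
  by rewrite big1 => [|j _]; rewrite ?andbF// ell2_supp ?if_same.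
case wi : (w i) => [|j a] /=; first by rewrite big1.
rewrite (bigD1 j)//= eqxx /= (D_tail _ Dw) big1 ?addr0 => [|j' j'j].
  case: ifP => // _; congr (ell2_val _ _).
  by apply/eqP; rewrite cons_tail_at wi.
by rewrite ifF//; apply/negbTE; apply: contraNN j'j => /andP[/eqP[->]].
Qed.

Lemma diagB (d e : pred W) : (forall w, e w -> d w) ->
  (fun h : H => diag d h - diag e h) =
  diag (fun w => d w && ~~ e w) :> (H -> H).
Proof.
move=> ed; apply/funext => x; apply: ell2P => w.
rewrite ell2D ell2N !diagE; have := ed w.
by case: (e w) => [->//|_]; rewrite ?subrr// andbT subr0.
Qed.

(** Each factor [id - Phi] with exponent 1 cuts the projection down to the
    tuples with an empty [i]-th word. The indices are distinct, so the
    condition accumulated so far does not see the removal of a letter of that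
    word. *)
Lemma Delta_pow_diag (p : 'I_k -> bool) :
  Delta_pow (@wshift) p idfun =
  diag (fun w => [forall i, p i ==> (w i == [::])]).
Proof.
have -> : diag (fun w => [forall i, p i ==> (w i == [::])]) =
    diag (fun w => all (fun i => p i ==> (w i == [::])) (index_enum 'I_k))
    :> (H -> H).
  apply: eq_diag => w; apply/forallP/allP => [h i _|h i]; first exact: h.
  by apply: h; rewrite mem_index_enum.
rewrite /Delta_pow; have := index_enum_uniq 'I_k.
elim: (index_enum 'I_k) => [_|i s IH /= /andP[is_ us]].
  by rewrite big_nil /= -[LHS](diagT); exact: eq_diag.
rewrite big_cons /= IH//; case: (p i) => /=; last exact: eq_diag.
rewrite Phi_diag.
have e w : all (fun l => p l ==> (tail_at i w l == [::])) s =
    all (fun l => p l ==> (w l == [::])) s.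
  apply: eq_in_all => l ls; rewrite tail_at_out//.
  by apply: contraNneq is_ => ->.
rewrite diagB => [|w /andP[_]]; last by rewrite e.
by apply: eq_diag => w; rewrite e; case: (w i == [::]); case: (all _ s).
Qed.

Lemma wshift_polyball : polyball (@wshift).
Proof.
split=> [i j||p x]; first exact: push_bounded_operator.
  exact: wshift_cross_commuting.
by rewrite Delta_pow_diag; exact: inner_diag_ge0.
Qed.

Lemma iter_Phi_diag i p :
  iter p (Phi (@wshift i)) idfun = diag (fun w => (p <= size (w i))%N).
Proof.
elim: p => [|p IH]; first by rewrite /= -[LHS](diagT); exact: eq_diag.
rewrite iterS IH Phi_diag; apply: eq_diag => w.
by rewrite tail_at_in; case: (w i).
Qed.

(** A projection that kills [A] leaves at most the mass of [x] outside [A];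
    this is what makes such projections small on [x]. *)
Lemma sqnorm_diag_le (d : pred W) (x : ell2 R D) (A : {fset W}) :
  (forall w, w \in A -> ~~ d w) ->
  sqnorm (diag d x) <= sqnorm x - psum (fun w => sqmod (x w)) A.
Proof.
move=> Ad; apply: sqnorm_le => B; rewrite lerBrDr.
apply: le_trans (psum_le_sqnorm x (A `|` B)%fset).
rewrite (psum_restrict _ (fsubsetUl A B)) (psum_restrict _ (fsubsetUr A B)).
rewrite -psumD.
apply: ler_psum => w; rewrite diagE; have := Ad w.
have := sqmod_ge0 (x w).
case: (w \in A) => [x0 /(_ isT)/negPf -> /=|x0 _].
  by rewrite sqmod0 if_same add0r.
by rewrite addr0; case: ifP => //; case: ifP => // _; rewrite sqmod0.
Qed.

(** A finite set [A] carries [x] up to a small error, and a power larger than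
    the lengths of the words in [A] kills all of [A]. *)
Lemma wshift_pure : pure (@wshift).
Proof.
move=> i x; apply/cvgrPdist_le => e e0.
have eE : e = (complex.Re e)%:C by rewrite RRe_real// gtr0_real.
move: e0; rewrite eE ltcR => r0; set r := complex.Re e in r0 *.
have r20 : 0 < r ^+ 2 by rewrite exprn_gt0.
have sx : square_summable (x : ell2 R D) := ell2_sum x.
have cx := cvg_psum (ge0_abs_summable (fun w => sqmod_ge0 _) sx).
have /cvgrPdist_le/(_ _ r20)[A _ /(_ A (fsubset_refl _)) /= Ar] := cx.
near=> p; have Ap : (\max_(w <- A) size (w i) < p)%N.
  by near: p; exists (\max_(w <- A) size (w i)).+1.
rewrite sub0r normrN iter_Phi_diag ell2_norm_le; last exact: ltW.
apply: le_trans Ar; apply: le_trans (ler_norm _).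
apply: sqnorm_diag_le => w wA; rewrite -ltnNge.
by apply: leq_ltn_trans Ap; apply: leq_bigmax_seq.
Unshelve. all: by end_near. Qed.

End CompressedShifts.

(** * Uniqueness of dimension *)

Section Dimension.
Variables (K : numFieldType) (V : lmodType K).

Lemma lspan_range d (e : 'I_d -> V) v :
  lspan (range e) v <-> exists a : 'I_d -> K, v = \sum_i a i *: e i.
Proof.
split=> [[m [c [u [ue ->]]]]|[a ->]]; last first.
  by exists d, a, e; split=> // i; exists i.
have /choice[f fE] : forall i, exists j, e j = u i.
  by move=> i; have [j _ <-] := ue i; exists j.
exists (fun j => \sum_(i | f i == j) c i).
rewrite (partition_big f predT)//=; apply: eq_bigr => j _.
by rewrite scaler_suml; apply: eq_bigr => i /eqP <-; rewrite fE.
Qed.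

Lemma lspan_range_lincomb d (e : 'I_d -> V) m (c : 'I_m -> K) (u : 'I_m -> V) :
  (forall i, lspan (range e) (u i)) -> lspan (range e) (\sum_i c i *: u i).
Proof.
move=> ue; have /choice[a aE] : forall i, exists a : 'I_d -> K,
  u i = \sum_j a j *: e j by move=> i; exact/lspan_range.
apply/lspan_range; exists (fun j => \sum_i c i * a i j).
under eq_bigr => i _ do rewrite aE scaler_sumr.
rewrite exchange_big/=; apply: eq_bigr => j _; rewrite scaler_suml.
by apply: eq_bigr => i _; rewrite scalerA.
Qed.

(** The matrix of coordinates of [e] in [e'] has independent rows, so that its
    rank, at most [d'], is [d]. *)
Lemma lin_indep_card_le d d' (e : 'I_d -> V) (e' : 'I_d' -> V) :
  lin_indep e -> (forall i, lspan (range e') (e i)) -> (d <= d')%N.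
Proof.
move=> ind ee'; have /choice[a aE] : forall i, exists a : 'I_d' -> K,
  e i = \sum_j a j *: e' j by move=> i; exact/lspan_range.
pose M := \matrix_(i < d, j < d') a i j.
suff /eqP <- : row_free M by exact: rank_leq_col.
apply: inj_row_free => v vM; apply/rowP => i; rewrite mxE.
apply: (ind (fun i => v 0 i)).
under eq_bigr => l _ do rewrite aE scaler_sumr.
rewrite exchange_big/= big1// => j _.
under eq_bigr => l _ do rewrite scalerA.
rewrite -scaler_suml; have /rowP/(_ j) := vM; rewrite !mxE.
by under eq_bigr => l _ do rewrite mxE; move=> ->; rewrite scale0r.
Qed.

Lemma sub_lspan (A : set V) : A `<=` lspan A.
Proof.
move=> v Av; exists 1%N, (fun=> 1), (fun=> v).
by split=> //; rewrite big_ord1 scale1r.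
Qed.

Lemma has_dim_le (A : set V) d d' : has_dim A d -> has_dim A d' -> (d <= d')%N.
Proof.
move=> [e [ind AE]] [e' [_ AE']].
apply: (lin_indep_card_le (e' := e') ind) => i.
by rewrite -AE' AE; apply: sub_lspan; exists i.
Qed.

Lemma lin_dimE (A : set V) d : has_dim A d -> lin_dim A = d.
Proof.
move=> Ad; have Ad' : has_dim A (lin_dim A) := xgetI 0%N Ad.
by apply/eqP; rewrite eqn_leq (has_dim_le Ad' Ad) (has_dim_le Ad Ad').
Qed.

End Dimension.

(** * Defect space and the spaces spanned by bounded words *)

Section CompressedShiftSpaces.
Variables (R : realType) (k : nat) (n : 'I_k -> nat).
Local Notation W := (words n).
Variable D : pred W.
Hypothesis D_tail : forall i w, D w -> D (tail_at i w).
Hypothesis D_empty : D (@empty_words k n).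
Local Notation H := (ell2_hilbert R D).
Local Notation T := (@wshift R k n D).

Lemma delta_l2 (w : W) :
  (fun v => if (v == w) && D v then 1 else 0 : R[i]) \in l2pred D.
Proof.
apply: (@dominated_l2pred _ _ _ _ (fun v => (v == w)%:R)) => [|v|v /negPf ->].
- exists 1 => A; apply: le_trans (psum_sub (B := (w |` A)%fset) _ _) _ => //.
    exact: fsubsetU1.
  rewrite /psum (bigD1_seq w) ?fset_uniq ?fset1U1//= eqxx big1 ?addr0// => v.
  by move=> /negPf ->.
- case: (v == w); case: (D v); rewrite /= ?sqmod0// /sqmod/=.
  by rewrite expr1n expr0n addr0.
- by rewrite andbF.
Qed.

(** The basis vector at [w], or [0] when [w] is outside [D]: with this
    convention shifts map basis vectors to basis vectors. *)
Definition delta w : ell2 R D := Ell2 (delta_l2 w).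

Lemma deltaE w v : delta w v = if (v == w) && D v then 1 else 0.
Proof. by []. Qed.

Arguments delta : simpl never.

Lemma wshift_delta i (j : 'I_(n i)) (a : R[i]) w :
  T j (a *: delta w) = a *: delta (cons_at j w) :> ell2 R D.
Proof.
apply: ell2P => v; rewrite wshiftE !ell2Z !deltaE -cons_tail_at.
have [Dv|_] := boolP (D v); last by rewrite !andbF mulr0.
rewrite (D_tail _ Dv) !andbT.
have [vE|vn] := eqVneq v (cons_at j w).
  by rewrite vE cons_atK !eqxx.
case: eqP => [cv|_]; last by rewrite mulr0.
by case: eqP => [tv|_]; rewrite ?mulr0//; rewrite -tv cv eqxx in vn.
Qed.

Definition prepend i (u : seq 'I_(n i)) (w : W) : W :=
  eqtype.dfwith w (u ++ w i).

Lemma word_op_delta i (u : seq 'I_(n i)) (a : R[i]) w :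
  word_op T u (a *: delta w) = a *: delta (prepend u w) :> ell2 R D.
Proof.
elim: u => [|j u IH].
  congr (_ *: delta _); apply: wordsP => l; rewrite /prepend/=.
  have [<-|il] := eqVneq i l; first by rewrite eqtype.dfwith_in.
  by rewrite eqtype.dfwith_out.
rewrite [LHS](_ : _ = T j (word_op T u (a *: delta w)))//.
rewrite IH wshift_delta; congr (_ *: delta _); apply: wordsP => l.
have [<-|il] := eqVneq i l.
  by rewrite cons_at_in /prepend !eqtype.dfwith_in.
by rewrite cons_at_out// /prepend !eqtype.dfwith_out.
Qed.

(** The operators at distinct indices act on distinct words, so their product
    builds the tuple [u] from the empty one, one word at a time. *)
Lemma words_op_delta (u : W) (a : R[i]) :
  (\big[(fun A B : H -> H => A \o B)/idfun]_(i < k) word_op T (u i))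
    (a *: delta (@empty_words k n)) = a *: delta u :> ell2 R D.
Proof.
have -> : u = (fun i => if i \in index_enum 'I_k then u i else [::]).
  by apply: wordsP => i; rewrite mem_index_enum.
rewrite (eq_bigr (fun i => word_op T (u i))); last first.
  by move=> i _; rewrite mem_index_enum.
have := index_enum_uniq 'I_k.
elim: (index_enum _) => [_|i s IH /= /andP[is_ us]].
  by rewrite big_nil.
rewrite big_cons [LHS]/= IH// word_op_delta; congr (_ *: delta _).
apply: wordsP => l; rewrite /prepend inE eq_sym.
have [<-|il] /= := eqVneq i l; last by rewrite eqtype.dfwith_out.
by rewrite eqtype.dfwith_in (negPf is_) cats0.
Qed.

Lemma defectE (x : ell2 R D) :
  defect T x = x (@empty_words k n) *: delta (@empty_words k n) :> ell2 R D.
Proof.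
rewrite /defect Delta_pow_diag//; apply: ell2P => w.
rewrite ell2Z deltaE diagE.
have -> : [forall i, true ==> (w i == [::])] = (w == @empty_words k n).
  apply/forallP/eqP => [w0|-> //]; apply: wordsP => i; exact/eqP/w0.
by case: eqP => [->|_] /=; rewrite ?D_empty ?mulr1 ?mulr0.
Qed.

Lemma range_defect :
  range (defect T) = [set a *: delta (@empty_words k n) | a in setT]
  :> set (ell2 R D).
Proof.
apply/seteqP; split=> v /= [x _ <-].
  by exists ((x : ell2 R D) (@empty_words k n)); rewrite // defectE.
exists (x *: delta (@empty_words k n)) => //.
by rewrite defectE ell2Z deltaE eqxx D_empty mulr1.
Qed.

Lemma delta_lin_indep d (f : 'I_d -> W) : injective f -> (forall i, D (f i)) ->
  lin_indep (fun i => delta (f i)).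
Proof.
move=> f_inj fD a a0 i.
have : ell2_val (\sum_j a j *: delta (f j)) (f i) = 0 by rewrite a0.
rewrite ell2_sumE (bigD1 i)// ell2Z deltaE eqxx fD mulr1 big1.
  by rewrite /= addr0.
by move=> j ji; rewrite ell2Z deltaE (inj_eq f_inj) eq_sym (negPf ji) mulr0.
Qed.

Lemma has_dim_defect : has_dim (range (defect T) : set (ell2 R D)) 1.
Proof.
exists (fun=> delta (@empty_words k n)); split.
  apply: (@delta_lin_indep 1 (fun=> @empty_words k n)) => // i j _.
  by rewrite !ord1.
rewrite range_defect; apply/seteqP; split=> v.
  by move=> [a _ <-]; apply/lspan_range; exists (fun=> a); rewrite big_ord1.
by move=> /lspan_range[a ->]; exists (a ord0); rewrite // big_ord1.
Qed.

Lemma rank_wshift : rank T = 1%N.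
Proof. exact: lin_dimE has_dim_defect. Qed.

Definition box (q : 'I_k -> nat) := {dffun forall i, {bseq (q i) of 'I_(n i)}}.

Definition box_words q (b : box q) : W := fun i => b i.

Lemma box_words_inj q : injective (@box_words q).
Proof.
move=> b b' bb'; apply/ffunP => i; apply: val_inj.
exact: (congr1 (fun w : W => w i) bb').
Qed.

Lemma M_spaceE q :
  M_space T q =
  lspan [set a *: delta w | a in setT &
                            w in [set w | forall i, (size (w i) <= q i)%N]]
    :> set (ell2 R D).
Proof.
congr lspan; apply/seteqP; split=> v.
  move=> [u [h [uq]]]; rewrite range_defect => -[a _ <-] ->.
  by exists a => //; exists u => //; rewrite -words_op_delta.
move=> [a _ [u uq <-]]; exists u, (a *: delta (@empty_words k n)).
by split=> //; [rewrite range_defect; exists a | rewrite words_op_delta].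
Qed.

(** Distinct tuples of [D] give independent basis vectors, and a tuple outside
    [D] gives the zero vector; the box of words of bounded lengths is a finite
    type, so its part in [D] indexes a basis. *)
Lemma has_dim_M_space q :
  has_dim (M_space T q : set (ell2 R D)) #|[pred b : box q | D (box_words b)]|.
Proof.
set S := [pred b : box q | D (box_words b)].
have SD (i : 'I_#|S|) : D (box_words (enum_val i)) by exact: (enum_valP i).
exists (fun i : 'I_#|S| => delta (box_words (enum_val i))); split.
  pose f (i : 'I_#|S|) := box_words (enum_val i).
  apply: (delta_lin_indep (f := f)) => //.
  by move=> i j /box_words_inj/enum_val_inj.
rewrite M_spaceE; apply/seteqP; split=> v; last first.
  move=> /lspan_range[a ->].
  exists #|S|, a, (fun i => delta (box_words (enum_val i))); split=> // i.
  exists 1 => //; exists (box_words (enum_val i)); last by rewrite scale1r.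
  by move=> l; rewrite /box_words size_bseq.
move=> [m [c [u [uS ->]]]]; apply: lspan_range_lincomb => i.
have [a _ [w wq <-]] := uS i.
have [Dw|nDw] := boolP (D w); last first.
  apply/lspan_range; exists (fun=> 0).
  rewrite big1 => [|? _]; last by rewrite scale0r.
  apply: ell2P => v0; rewrite ell2Z deltaE ell2_0.
  by case: eqP => [->|_]; rewrite ?(negPf nDw) /= mulr0.
pose b : box q := [ffun i => Bseq (wq i)].
have bw : box_words b = w by apply: wordsP => l; rewrite /box_words ffunE.
have bS : b \in S by rewrite inE bw.
apply/lspan_range; exists (fun i => if i == enum_rank_in bS b then a else 0).
rewrite (bigD1 (enum_rank_in bS b))//= eqxx enum_rankK_in// bw big1 ?addr0//.
by move=> j /negPf ->; rewrite scale0r.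
Qed.

Lemma euler_ratio_wshift q : euler_ratio T q =
  #|[pred b : box q | D (box_words b)]|%:R /
  (\prod_(i < k) \sum_(l < (q i).+1) n i ^ l)%N%:R.
Proof. by rewrite /euler_ratio (lin_dimE (has_dim_M_space q)). Qed.

End CompressedShiftSpaces.

(** * A subtree of words of prescribed density *)

Definition words_upto n q := (\sum_(l < q.+1) n ^ l)%N.

(** A quadratic lower bound is enough to absorb the linear error of the count of
    words in [card_below_bounds]; it holds because [n ^ l] exceeds [l]. *)
Lemma words_upto_ge n q : (2 <= n)%N ->
  (q.+1 * q.+1 <= 2 * words_upto n q)%N.
Proof.
move=> n2; rewrite /words_upto; elim: q => [|q IH]; first by rewrite big_ord1.
rewrite big_ord_recr /= mulnDr.
have : (q.+2 <= n ^ q.+1)%N.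
  by apply: leq_trans (ltn_expl _ (ltnSn 1)) _; rewrite leq_exp2r.
move: IH; set S := (\sum_(l < q.+1) _)%N; set N := (n ^ q.+1)%N => IH qN.
nia.
Qed.

Section Counting.
Variables (R : realType) (n : nat) (t : R).
Hypotheses (n2 : (2 <= n)%N) (t01 : 0 <= t <= 1).
Implicit Types u : seq 'I_n.

(** Value of a word in base [n], with the most significant digit last: removing
    the first letter forgets the least significant digit. *)
Definition value u : nat := foldr (fun (j : 'I_n) v => n * v + j)%N 0%N u.

(** The words whose base-[n] expansion, read as a number in [0, 1[, is smaller
    than [t]. The empty word is added, for otherwise [t = 0] would leave no word
    and a zero defect. *)
Definition below u : bool :=
  (u == [::]) || ((value u)%:R < t * (n ^ size u)%:R).

(** Forgetting the least significant digit does not increase the number. *)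
Lemma below_behead u : below u -> below (behead u).
Proof.
case: u => [//|j u]; rewrite /below /= => uj; apply/orP; right.
have n0 : (0 : R) < n%:R by rewrite ltr0n; exact: leq_trans n2.
rewrite -(ltr_pM2l n0); apply: le_lt_trans (_ : (n * value u + j)%:R < _).
  by rewrite -natrM ler_nat leq_addr.
by apply: lt_le_trans uj _; rewrite expnS natrM mulrCA.
Qed.

Lemma value_lt u : (value u < n ^ size u)%N.
Proof.
elim: u => [//|j u IH] /=; rewrite expnS.
apply: (@leq_trans (n * (value u).+1)); last by rewrite leq_mul2l IH orbT.
by rewrite mulnS [leqRHS]addnC ltn_add2l.
Qed.

Lemma value_inj u u' : size u = size u' -> value u = value u' -> u = u'.
Proof.
elim: u u' => [|j u IH] [|j' u']//= [suu'] e.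
have n0 : (0 < n)%N by exact: leq_trans n2.
have jj' : j = j'.
  apply: ord_inj; have := congr1 (modn^~ n) e.
  by rewrite /= !(mulnC n) !modnMDl !modn_small.
congr (_ :: _) => //; apply: IH => //; apply/eqP.
by move: e; rewrite jj' => /addIn/eqP; rewrite eqn_pmul2l.
Qed.

(** Every number below [n ^ l] has exactly one expansion with [l] digits. *)
Lemma card_tuple_value l (P : pred nat) :
  #|[pred s : l.-tuple 'I_n | P (value s)]| = #|[pred m : 'I_(n ^ l) | P m]|.
Proof.
have val_lt (s : l.-tuple 'I_n) : (value s < n ^ l)%N.
  by have := value_lt s; rewrite size_tuple.
pose f s := Ordinal (val_lt s).
have f_inj : injective f.
  move=> s s' /(congr1 val) /= e; apply: val_inj; apply: value_inj e.
  by rewrite !size_tuple.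
have f_bij : bijective f.
  by apply: inj_card_bij f_inj _; rewrite card_ord card_tuple card_ord.
rewrite -(on_card_preimset (onW_bij _ f_bij)).
by apply: eq_card => s; rewrite !inE.
Qed.

(** The count is the least natural number that is at least [T]. *)
Lemma card_below_level l (T : R) : 0 <= T <= (n ^ l)%:R ->
  T <= #|[pred m : 'I_(n ^ l) | (m%:R : R) < T]|%:R <= T + 1.
Proof.
move=> /andP[T0 TN].
have exK : exists K, T <= K%:R by exists (n ^ l)%N.
case: (ex_minnP exK) => K TK Kmin.
have -> : #|[pred m : 'I_(n ^ l) | (m%:R : R) < T]| = K.
  transitivity (\sum_(m < K) 1)%N; last by rewrite sum_nat_const card_ord muln1.
  rewrite -sum1_card (big_ord_widen (n ^ l) (fun=> 1%N)) ?Kmin//.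
  apply: eq_bigl => m; rewrite inE; apply/idP/idP => [mT|mK].
    by rewrite -(ltr_nat R); exact: lt_le_trans TK.
  by rewrite ltNge; apply: contraTN mK => /Kmin; rewrite -leqNgt.
rewrite TK /=; case: K TK Kmin => [|K] TK Kmin; first by rewrite addr_ge0.
rewrite -natr1 lerD2r leNgt; apply/negP => /ltW /Kmin.
by rewrite ltnn.
Qed.

Lemma card_below_tuple l :
  t * (n ^ l)%:R <= #|[pred s : l.-tuple 'I_n | below s]|%:R
    <= t * (n ^ l)%:R + 1.
Proof.
have /andP[t0 t1] := t01.
case: l => [|l].
  rewrite (eq_card (B := predT)) => [|s]; last by rewrite !inE tuple0.
  by rewrite cardT -cardE card_tuple expn0 mulr1 t1 lerDr.
rewrite (eq_card (B := [pred s : l.+1.-tuple 'I_n |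
    [pred m : nat | m%:R < t * (n ^ l.+1)%:R] (value s)])); last first.
  by case=> -[//|j s] ss; rewrite !inE /below /= -(eqP ss).
rewrite card_tuple_value; apply: card_below_level.
by rewrite mulr_ge0//= -[leRHS]mul1r ler_wpM2r.
Qed.

Lemma card_below_bseq q :
  #|[pred b : {bseq q of 'I_n} | below b]| =
  (\sum_(l < q.+1) #|[pred s : l.-tuple 'I_n | below s]|)%N.
Proof.
rewrite -sum1_card (reindex tagged_tuple_bseq); last first.
  by apply: onW_bij; exact: tagged_tuple_bseq_bij.
under [RHS]eq_bigr do rewrite -sum1_card.
rewrite sig_big_dep/=; by apply: eq_bigl => s; rewrite !inE.
Qed.

Lemma card_below_bounds q :
  t * (words_upto n q)%:R <= #|[pred b : {bseq q of 'I_n} | below b]|%:R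
    <= t * (words_upto n q)%:R + q.+1%:R.
Proof.
rewrite card_below_bseq /words_upto !natr_sum mulr_sumr.
have -> : q.+1%:R = \sum_(l < q.+1) 1 :> R by rewrite sumr_const card_ord.
rewrite -big_split/=; apply/andP; split; apply: ler_sum => l _;
  by have /andP[] := card_below_tuple l.
Qed.

End Counting.

(** * Euler characteristic *)

Section EulerCharacteristic.
Variables (R : realType) (k : nat) (n : 'I_k -> nat) (i0 : 'I_k) (t : R).
Hypotheses (n2 : forall i, (2 <= n i)%N) (t01 : 0 <= t <= 1).

Definition below_at : pred (words n) := fun w => below t (w i0).

Lemma below_at_tail i w : below_at w -> below_at (tail_at i w).
Proof.
rewrite /below_at; have [->|ii0] := eqVneq i i0; last by rewrite tail_at_out.
by rewrite tail_at_in; exact: below_behead.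
Qed.

Lemma below_at_empty : below_at (@empty_words k n). Proof. by []. Qed.

(** The condition bears on the word of index [i0] alone, so the other indices
    contribute all their words, as they do in the denominator of the ratio. *)
Lemma card_below_at_box q :
  #|[pred b : box n q | below_at (box_words b)]| =
  (#|[pred b : {bseq (q i0) of 'I_(n i0)} | below t b]| *
   \prod_(i < k | i != i0) words_upto (n i) (q i))%N.
Proof.
pose F i : pred {bseq (q i) of 'I_(n i)} :=
  fun b => (i == i0) ==> below t b.
have -> : #|[pred b : box n q | below_at (box_words b)]| =
    #|(family F : simpl_pred (box n q))|.
  apply: eq_card => b; rewrite inE; apply/idP/familyP => [bi i|/(_ i0)].
    by apply/implyP => /eqP ->.
  by rewrite /F unfold_in eqxx.
rewrite card_family foldrE big_map big_enum/= (bigD1 i0)//=; congr (_ * _)%N.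
  by apply: eq_card => b; rewrite !inE /F unfold_in eqxx.
apply: eq_bigr => i /negPf ii0.
rewrite (eq_card (B := predT)) => [|b]; last by rewrite unfold_in /F ii0.
by rewrite card_bseq card_ord.
Qed.

Lemma words_upto_gt0 i q : (0 < words_upto (n i) q)%N.
Proof.
have := words_upto_ge q (n2 i).
by case: (words_upto _ _) => //; rewrite muln0.
Qed.

Lemma euler_ratio_bounds q :
  t <= euler_ratio (@wshift R k n below_at) q <= t + 2 / (q i0).+1%:R.
Proof.
rewrite euler_ratio_wshift; [|exact: below_at_tail|exact: below_at_empty].
have -> : (\prod_(i < k) \sum_(l < (q i).+1) n i ^ l =
    words_upto (n i0) (q i0) *
    \prod_(i < k | i != i0) words_upto (n i) (q i))%N.
  by rewrite (bigD1 i0).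
rewrite card_below_at_box !natrM; set P := (\prod_(i < k | i != i0) _)%N.
have P0 : P%:R != 0 :> R.
  by rewrite pnatr_eq0 -lt0n prodn_cond_gt0// => i _; exact: words_upto_gt0.
rewrite -mulf_div (divff P0) mulr1.
have := card_below_bounds (n2 i0) t01 (q i0).
have := words_upto_ge (q i0) (n2 i0).
set S := words_upto _ _; set c := #|_| => SqN /andP[tc ct].
have S0 : 0 < S%:R :> R by rewrite ltr0n words_upto_gt0.
rewrite ler_pdivlMr// tc /= ler_pdivrMr//.
apply: le_trans ct _; rewrite mulrDl lerD2l mulrAC ler_pdivlMr// -!natrM.
by rewrite ler_nat.
Qed.

Lemma euler_characteristic_below :
  has_euler_characteristic (@wshift R k n below_at) t.
Proof.
split.
  exists 1%N; apply: has_dim_defect; [exact: below_at_tail|].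
  exact: below_at_empty.
move=> q [q_incr q_cofinal]; apply/cvgrPdist_le => e e0.
have [m0 qm0] := q_cofinal (fun=> Num.bound (2 / e)).
(* Beyond m0 the error 2 / (q m i0 + 1) is at most e. *)
exists m0 => // m /= m0m.
have qm : (Num.bound (2 / e) <= q m i0)%N.
  apply: leq_trans (qm0 i0) _.
  have mono : {homo (fun l => q l i0) : a b / (a <= b)%N}.
    by apply: homo_leq => // ? ? ?; exact: leq_trans.
  exact: mono m0m.
have /andP[tr rt] := euler_ratio_bounds (q m).
rewrite distrC ger0_norm ?subr_ge0// lerBlDl; apply: le_trans rt _.
rewrite lerD2l.
rewrite ler_pdivrMr// mulrC -ler_pdivrMr//.
apply: le_trans (ltW (archi_boundP _)) _; first by rewrite divr_ge0// ltW.
by rewrite ler_nat ltnW.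
Qed.

End EulerCharacteristic.

Theorem corollary2p7 (R : realType) (k : nat) (n : 'I_k -> nat)
    (hk : (0 < k)%N) (hn : forall i, (2 <= n i)%N)
    (t : R) (ht : 0 <= t <= 1) :
  exists (H : hilbertType R) (T : forall i : 'I_k, 'I_(n i) -> H -> H),
    [/\ polyball T, pure T, rank T = 1%N & has_euler_characteristic T t].
Proof.
pose i0 := Ordinal hk.
have tailD i w : below_at i0 t w -> below_at i0 t (tail_at (n := n) i w).
  exact: below_at_tail.
exists (ell2_hilbert R (below_at (n := n) i0 t)), (@wshift R k n _); split.
- exact: wshift_polyball.
- exact: wshift_pure.
- exact: rank_wshift.
- exact: euler_characteristic_below.
Qed.
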